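(* (a) Consider 3-Majority with $k\le c\sqrt{n/\log n}$, where $c>0$ is a sufficiently small constant. Then there exists an initial configuration from which the consensus time is $\Omega(k)$ with high probability. (b) Consider 2-Choices with $k\le c\,n/\log n$, where $c>0$ is a sufficiently small constant. Then there exists an initial configuration from which the consensus time is $\Omega(k)$ with high probability.
   Context: **Setting.** Let $V$ be a set of $n$ vertices and $k\in\{1,\dots,n\}$. A configuration is a map $\mathsf{opn}\colon V\to[k]$. The process is synchronous: each round $t\ge1$ produces $\mathsf{opn}_t$ from $\mathsf{opn}_{t-1}$, and all vertices make their choices independently. **3-Majority.** Each vertex $v$ samples $w_1,w_2,w_3\in V$ independently and uniformly, with replacement. It sets $\mathsf{opn}_t(v)=\mathsf{opn}_{t-1}(w_1)$ if $\mathsf{opn}_{t-1}(w_1)=\mathsf{opn}_{t-1}(w_2)$, and $\mathsf{opn}_t(v)=\mathsf{opn}_{t-1}(w_3)$ otherwise. **2-Choices.** Each vertex $v$ samples $w_1,w_2\in V$ independently and uniformly, with replacement. It sets $\mathsf{opn}_t(v)=\mathsf{opn}_{t-1}(w_1)$ if $\mathsf{opn}_{t-1}(w_1)=\mathsf{opn}_{t-1}(w_2)$, and $\mathsf{opn}_t(v)=\mathsf{opn}_{t-1}(v)$ otherwise. **Consensus time.** $\tau_{\mathrm{cons}}=\inf\{t\ge0:\exists i\ \forall v,\ \mathsf{opn}_t(v)=i\}$. **Conventions.** ''With high probability'' means with probability $1-O(n^{-c'})$ for some constant $c'>0$.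
   Formalization: The formal statement assumes k ≥ 2; for k = 1 every configuration is already a consensus, so the consensus time is 0 and the Ω(k) bound fails. *)

(* Defs.v *)
From HB Require Import structures.
From mathcomp Require Import all_boot all_order all_algebra.
From mathcomp Require Import reals exp.
Set Implicit Arguments. Unset Strict Implicit. Unset Printing Implicit Defensive.
Import Order.TTheory GRing.Theory Num.Theory.
Local Open Scope ring_scope.

Section Opinion.
Variables (R : realType) (n k : nat).

(* Vertices V = 'I_n, opinions [k] = 'I_k. *)
Definition config := {ffun 'I_n -> 'I_k}.

Definition consensus (x : config) : bool :=
  [exists i : 'I_k, [forall v : 'I_n, x v == i]].

Definition maj3_out (x : config) (w : 'I_n * 'I_n * 'I_n) : 'I_k :=
  let: (w1, w2, w3) := w in if x w1 == x w2 then x w1 else x w3.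

Definition ch2_out (x : config) (v : 'I_n) (w : 'I_n * 'I_n) : 'I_k :=
  let: (w1, w2) := w in if x w1 == x w2 then x w1 else x v.

(* probability that vertex v adopts opinion i in the next round,
   samples independent uniform with replacement *)
Definition three_majority (x : config) (v : 'I_n) (i : 'I_k) : R :=
  #|[set w : 'I_n * 'I_n * 'I_n | maj3_out x w == i]|%:R / (n ^ 3)%:R.

Definition two_choices (x : config) (v : 'I_n) (i : 'I_k) : R :=
  #|[set w : 'I_n * 'I_n | ch2_out x v w == i]|%:R / (n ^ 2)%:R.

(* synchronous round: vertices choose independently *)
Definition trans (rule : config -> 'I_n -> 'I_k -> R) (x y : config) : R :=
  \prod_(v : 'I_n) rule x v (y v).

(* survive rule x0 t y = Pr[ opn_0 .. opn_t are all non-consensus and opn_t = y ]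
   for the chain started from x0 *)
Fixpoint survive (rule : config -> 'I_n -> 'I_k -> R) (x0 : config) (t : nat)
  (y : config) : R :=
  match t with
  | 0 => if (y == x0) && ~~ consensus y then 1 else 0
  | t'.+1 => (if consensus y then 0 else 1) *
             \sum_(x : config) survive rule x0 t' x * trans rule x y
  end.

Definition Pr_tau_ge (rule : config -> 'I_n -> 'I_k -> R) (x0 : config) (T : nat) : R :=
  match T with
  | 0 => 1
  | T'.+1 => \sum_(y : config) survive rule x0 T' y
  end.

End Opinion.

(* Main.v *)
Require Import Defs.
From mathcomp Require Import all_boot all_order all_algebra.
From mathcomp Require Import reals sequences exp ring lra.
Set Implicit Arguments.
Unset Strict Implicit.
Unset Printing Implicit Defensive.
Import Order.TTheory GRing.Theory Num.Theory.
Local Open Scope ring_scope.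

(** Start from the balanced configuration and let [S_i] be the number of vertices
holding opinion [i]. As long as [S_i <= 2n/k], one round multiplies the expectation
of [S_i] by at most [1 + 2/k], and the vertices choose independently, so
[E exp(mu S_i') <= exp(mu (1 + 6/k) S_i)] for all [mu <= L], where [L = 1/k] for
3-Majority and [L = 1/2] for 2-Choices (in which only about [S_i^2 / n] vertices can
newly adopt [i]). Letting the rate [mu] shrink by [1 + 6/k] in each round, the
truncated potential [min(1, sum_i exp(mu S_i - mu_0 2n/k))] is a supermartingale
which equals 1 at consensus. Over [k/24] rounds the rate changes by a factor at most
[4/3], so consensus is reached with probability at most
[k exp(L - L n / (2k))], which is [O(1/n)] in the given ranges of [k]. *)

(** * Survival probabilities and exponential moments for a general rule *)

Section ExitTime.
Variables (R : realType) (n k : nat).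
Variable rule : config n k -> 'I_n -> 'I_k -> R.
Hypothesis rule_ge0 : forall x v i, 0 <= rule x v i.
Hypothesis rule_sum1 : forall x v, \sum_i rule x v i = 1.

Lemma trans_ge0 x y : 0 <= trans rule x y.
Proof. by rewrite /trans prodr_ge0. Qed.

Lemma trans_sum1 x : \sum_y trans rule x y = 1.
Proof.
rewrite /trans -(bigA_distr_bigA (fun v i => rule x v i)).
by rewrite big1.
Qed.

Lemma survive_ge0 x0 t y : 0 <= survive rule x0 t y.
Proof.
elim: t y => [|t IH] y /=; first by case: ifP.
apply: mulr_ge0; first by case: ifP.
by apply: sumr_ge0 => x _; rewrite mulr_ge0 ?trans_ge0.
Qed.

(* [1 - u m x] is a lower bound for the probability of surviving [m] more rounds
   from [x]; the induction propagates it forward through [survive]. *)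
Lemma survive_potential (u : nat -> config n k -> R) (T : nat) (x0 : config n k) :
  (forall m x, consensus x -> u m x = 1) ->
  (forall m x, (m < T)%N -> \sum_y trans rule x y * u m y <= u m.+1 x) ->
  forall t m, (t + m <= T)%N ->
  1 - u (t + m)%N x0 <= \sum_y survive rule x0 t y * (1 - u m y).
Proof.
move=> u_cons u_step; elim=> [|t IH] m le_T.
  rewrite (bigD1 x0) //= big1 ?addr0 => [|y /negPf->]; last by rewrite mul0r.
  rewrite eqxx /=; case: ifP => [_|/negbFE/u_cons->]; first by rewrite mul1r.
  by rewrite subrr mulr0.
rewrite addSnnS; apply: le_trans (IH m.+1 _) _; first by rewrite -addSnnS.
rewrite [leRHS](_ : _ =
  \sum_y \sum_x survive rule x0 t x * (trans rule x y * (1 - u m y))).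
  rewrite exchange_big /=; apply: ler_sum => x _.
  rewrite -mulr_sumr ler_wpM2l ?survive_ge0 //.
  under [leRHS]eq_bigr => y _ do rewrite mulrBr mulr1.
  rewrite sumrB trans_sum1 lerB // u_step //.
  by apply: leq_trans le_T; rewrite addSn ltnS leq_addl.
(* The factor [1 - u m y] vanishes at consensus, so the killing built into [survive] loses
   nothing. *)
apply: eq_bigr => y _ /=; case: ifP => [/u_cons->|_].
  by rewrite subrr mulr0; rewrite big1 // => x _; rewrite !mulr0.
by rewrite mul1r mulr_suml; apply: eq_bigr => x _; rewrite mulrA.
Qed.

Definition opinion_count (x : config n k) (i : 'I_k) : nat := #|[set v | x v == i]|.

Lemma opinion_count_sum (x : config n k) i :
  opinion_count x i = (\sum_v (x v == i))%N.
Proof.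
rewrite /opinion_count -sum1_card [RHS]big_mkcond /= big_mkcond /=.
by apply: eq_bigr => v _; rewrite inE; case: (x v == i).
Qed.

Lemma expR_opinion_count (mu : R) x i :
  expR (mu * (opinion_count x i)%:R) = \prod_v expR (mu * (x v == i)%:R).
Proof. by rewrite opinion_count_sum natr_sum mulr_sumr expR_sum. Qed.

(** Given [x], the events [y v == i] are independent over [v], so the exponential moment factors
    into Bernoulli ones. *)
Lemma mgf_opinion_count (mu : R) x i :
  \sum_y trans rule x y * expR (mu * (opinion_count y i)%:R) =
  \prod_v (1 + rule x v i * (expR mu - 1)).
Proof.
transitivity (\prod_v \sum_j rule x v j * expR (mu * (j == i)%:R)).
  rewrite (bigA_distr_bigA (fun v j => rule x v j * expR (mu * (j == i)%:R))) /=.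
  by apply: eq_bigr => y _; rewrite expR_opinion_count /trans -big_split.
apply: eq_bigr => v _; have := rule_sum1 x v.
rewrite (bigD1 i) //= [in X in _ -> X](bigD1 i) //= eqxx mulr1 => sum1.
under eq_bigr => j /negPf ne do rewrite ne mulr0 expR0 mulr1.
lra.
Qed.

(** * Escape from a balanced configuration *)

Section Escape.
Variable L : R.
Hypotheses (L_gt0 : 0 < L) (k_gt1 : (1 < k)%N).
Let growth : R := 1 + 6 / k%:R.
Let threshold : R := 2 * (n%:R / k%:R).
Hypothesis mgf_growth : forall x i (mu : R), 0 <= mu -> mu <= L ->
  (opinion_count x i)%:R <= threshold ->
  \sum_y trans rule x y * expR (mu * (opinion_count y i)%:R) <=
  expR (mu * growth * (opinion_count x i)%:R).

(** Here [m] counts the rounds that remain, so the rate falls as the process runs. The factor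
    [3 / 4] keeps it below [L] as long as [growth ^+ m <= 4 / 3]. *)
Let rate m : R := 3 / 4 * L * growth ^+ m.
Let expo m (x : config n k) : R :=
  \sum_i expR (rate m * (opinion_count x i)%:R - rate 0 * threshold).
(* Truncating at 1 makes the one-round inequality trivial once some opinion
   exceeds the threshold, where [mgf_growth] is not available. *)
Let pot m x : R := Num.min 1 (expo m x).

Let k_gt0 : 0 < k%:R :> R.
Proof. by rewrite ltr0n ltnW. Qed.

Let growth_ge1 : 1 <= growth.
Proof. by rewrite /growth lerDl divr_ge0 // ltW. Qed.

Let rate0_gt0 : 0 < 3 / 4 * L.
Proof. by rewrite mulr_gt0 // divr_gt0. Qed.

Let rate_ge0 m : 0 <= rate m.
Proof. by rewrite mulr_ge0 ?exprn_ge0 ?(le_trans ler01 growth_ge1) // ltW. Qed.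

Let rate_le m : rate 0 <= rate m.
Proof. by rewrite /rate expr0 ler_pM2l ?exprn_ege1. Qed.

Let pot_above m x i : threshold <= (opinion_count x i)%:R -> pot m x = 1.
Proof.
move=> le_c; apply/min_idPl; rewrite /expo (bigD1 i) //=.
rewrite -[leLHS]addr0 lerD ?sumr_ge0 // => [|j _]; last exact: expR_ge0.
rewrite -[leLHS]expR0 ler_expR subr_ge0 ler_pM ?rate_ge0 ?rate_le //.
by rewrite /threshold mulr_ge0 ?divr_ge0 // ltW.
Qed.

Let pot_consensus m x : consensus x -> pot m x = 1.
Proof.
case/existsP=> i /forallP /= xi; apply: (@pot_above _ _ i).
have -> : opinion_count x i = n.
  rewrite /opinion_count -[RHS]card_ord -cardsT; apply: eq_card => v.
  by rewrite !inE xi.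
(* The unanimous opinion has count [n], which reaches [2 n / k] because [k >= 2]. *)
rewrite /threshold mulrCA ler_piMr // ler_pdivrMr // mul1r.
by rewrite (ler_nat _ 2).
Qed.

Let pot_le1 m x : pot m x <= 1.
Proof. by rewrite /pot ge_min lexx. Qed.

Let pot_step m x : rate m <= L -> \sum_y trans rule x y * pot m y <= pot m.+1 x.
Proof.
move=> le_L; have le1 : \sum_y trans rule x y * pot m y <= 1.
  rewrite -(trans_sum1 x); apply: ler_sum => y _.
  by rewrite ler_piMr ?trans_ge0.
have [/existsP[i /pot_above->//]|/existsPn below] :=
  boolP [exists i, threshold <= (opinion_count x i)%:R].
rewrite le_min le1 /=.
apply: (@le_trans _ _ (\sum_y trans rule x y * expo m y)).
  by apply: ler_sum => y _; rewrite ler_wpM2l ?trans_ge0 // ge_min lexx orbT.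
under eq_bigr => y _ do rewrite mulr_sumr.
rewrite exchange_big /=; apply: ler_sum => i _.
under eq_bigr => y _ do rewrite expRD mulrA.
rewrite -mulr_suml expRD ler_wpM2r ?expR_ge0 // /rate exprSr !mulrA.
by apply: mgf_growth => //; [exact: rate_ge0 | rewrite ltW // real_ltNge // ?num_real].
Qed.

(** With [q = n / k], each of the [k] exponents of the initial potential is at most
    [L (q + 1) - (3/4) L (2 q) = L - L q / 2]. *)
Lemma escape_probability (x0 : config n k) (T : nat) :
  (forall i, (opinion_count x0 i)%:R <= n%:R / k%:R + 1 :> R) ->
  growth ^+ T <= 4 / 3 ->
  1 - k%:R * expR (L - L * (n%:R / k%:R) / 2) <= \sum_y survive rule x0 T y.
Proof.
move=> x0_bal growth_T.
have rate_L m : (m <= T)%N -> rate m <= L.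
  move=> le_mT; have : growth ^+ m <= growth ^+ T by rewrite ler_weXn2l.
  move/le_trans/(_ growth_T)/(ler_wpM2l (ltW rate0_gt0)).
  by rewrite -/(rate m); move/le_trans; apply; lra.
apply: (@le_trans _ _ (1 - pot (T + 0)%N x0)).
  rewrite lerB // addn0 ge_min; apply/orP; right.
  rewrite -[k in k%:R * _]card_ord mulr_natl -sumr_const.
  apply: ler_sum => i _; rewrite ler_expR.
  have := x0_bal i; have := rate_L T (leqnn _); have := rate_ge0 T.
  rewrite (_ : rate 0 = 3 / 4 * L) /threshold; last by rewrite /rate expr0 mulr1.
  set c := (opinion_count _ _)%:R; set q := n%:R / k%:R => r0 rL cq.
  have c0 : 0 <= c by rewrite ler0n.
  have : rate T * c <= L * (q + 1) by rewrite ler_pM.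
  lra.
apply: (le_trans (@survive_potential pot T x0 pot_consensus _ T 0 _)).
- by move=> m x lt_mT; apply/pot_step/rate_L/ltnW.
- by rewrite addn0.
apply: ler_sum => y _; rewrite ler_piMr ?survive_ge0 // lerBlDr lerDl.
by rewrite le_min ler01 sumr_ge0 // => i _; exact: expR_ge0.
Qed.
End Escape.
End ExitTime.

(** From [expR (- mu) >= 1 - mu] and [(1 - mu) (1 + mu + 2 mu^2) = 1 + mu^2 (1 - 2 mu) >= 1]. *)
Lemma expR_le_quadratic (R : realType) (mu : R) :
  0 <= mu -> mu <= 1 / 2 -> expR mu <= 1 + mu + 2 * mu ^+ 2.
Proof.
move=> mu0 mu1.
have pos : 0 < 1 - mu by lra.
have : (1 - mu) * expR mu <= 1.
  rewrite -[leRHS]expR0 -(subrr mu) expRD mulrC ler_pM2l ?expR_gt0 //.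
  exact: expR_ge1Dx.
rewrite mulrC -ler_pdivlMr // => /le_trans; apply.
rewrite ler_pdivrMr //; nra.
Qed.

Lemma card_fibers_sum1 (R : realType) (W : finType) (k : nat) (f : W -> 'I_k)
    (N : nat) :
  (0 < N)%N -> #|W| = N -> \sum_i #|[set w | f w == i]|%:R / N%:R = 1 :> R.
Proof.
move=> N_gt0 cW; rewrite -mulr_suml -natr_sum.
rewrite (_ : (\sum_i _)%N = N) ?divff ?pnatr_eq0 -?lt0n //.
rewrite -cW -sum1_card (partition_big f xpredT) //=.
by apply: eq_bigr => i _; rewrite sum1dep_card.
Qed.

(** * One-round bounds for 3-Majority and 2-Choices *)

Section Rules.
Variables (R : realType) (n k : nat).
Hypothesis n_gt0 : (0 < n)%N.
Implicit Types (x : config n k) (v : 'I_n) (i : 'I_k).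

Lemma three_majority_ge0 x v i : 0 <= three_majority R x v i.
Proof. exact: divr_ge0. Qed.

Lemma two_choices_ge0 x v i : 0 <= two_choices R x v i.
Proof. exact: divr_ge0. Qed.

Lemma three_majority_sum1 x v : \sum_i three_majority R x v i = 1.
Proof.
apply: card_fibers_sum1; first by rewrite expn_gt0 n_gt0.
by rewrite !card_prod !card_ord !expnS muln1 mulnA.
Qed.

Lemma two_choices_sum1 x v : \sum_i two_choices R x v i = 1.
Proof.
by apply: card_fibers_sum1; rewrite ?expn_gt0 ?n_gt0 // !card_prod !card_ord.
Qed.

(** Union bound: adopting [i] requires that [w3] holds [i] or that both [w1] and [w2] do. *)
Lemma three_majority_le x v i (s := (opinion_count x i)%:R : R) :
  three_majority R x v i <= s / n%:R * (1 + s / n%:R).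
Proof.
have n0 : 0 < n%:R :> R by rewrite ltr0n.
pose A := [set v | x v == i].
have sub : [set w | maj3_out x w == i] \subset
    setX [set: 'I_n * 'I_n] A :|: setX (setX A A) [set: 'I_n].
  apply/subsetP => -[[w1 w2] w3]; rewrite !inE /= andbT.
  by case: (eqVneq (x w1) (x w2)) => [-> ->|_ ->] //; rewrite orbT.
have := leq_trans (subset_leq_card sub) (leq_card_setU _ _).
rewrite !cardsX !cardsT card_prod !card_ord -/(opinion_count x i) -(ler_nat R).
rewrite natrD !natrM -/s /three_majority natrX => le_c.
rewrite ler_pdivrMr ?exprn_gt0 //; apply: le_trans le_c _.
rewrite [leRHS](_ : _ = n%:R * n%:R * s + s * s * n%:R) //.
by field; rewrite gt_eqF.
Qed.

Lemma two_choices_le x v i (s := (opinion_count x i)%:R : R) :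
  x v != i -> two_choices R x v i <= (s / n%:R) ^+ 2.
Proof.
move=> xv; have n0 : 0 < n%:R :> R by rewrite ltr0n.
pose A := [set v | x v == i].
have sub : [set w | ch2_out x v w == i] \subset setX A A.
  apply/subsetP => -[w1 w2]; rewrite !inE /=.
  by case: (eqVneq (x w1) (x w2)) => [-> ->|_] //; rewrite (negPf xv).
have := subset_leq_card sub.
rewrite cardsX -/(opinion_count x i) -(ler_nat R) natrM -/s => le_c.
by rewrite /two_choices natrX expr_div_n ler_pM2r ?invr_gt0 ?exprn_gt0.
Qed.

Lemma two_choices_le1 x v i : two_choices R x v i <= 1.
Proof.
rewrite -(two_choices_sum1 x v) (bigD1 i) //= lerDl sumr_ge0 // => j _.
exact: two_choices_ge0.
Qed.

(** The bound [mu <= 1 / k] makes the second-order term of [expR mu] cost a factor [1 + 2 / k], the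
    same as the drift. *)
Lemma three_majority_mgf x i (mu : R) : (1 < k)%N ->
  0 <= mu -> mu <= k%:R^-1 ->
  (opinion_count x i)%:R <= 2 * (n%:R / k%:R) :> R ->
  \sum_y trans (@three_majority R n k) x y * expR (mu * (opinion_count y i)%:R)
    <= expR (mu * (1 + 6 / k%:R) * (opinion_count x i)%:R).
Proof.
move=> k_gt1 mu0 muk; rewrite mgf_opinion_count; last exact: three_majority_sum1.
have n0 : 0 < n%:R :> R by rewrite ltr0n.
set s : R := (opinion_count x i)%:R => s_le.
have s0 : 0 <= s by rewrite ler0n.
set e := k%:R^-1 in muk s_le *.
have e0 : 0 < e by rewrite invr_gt0 ltr0n ltnW.
have e1 : e <= 1 / 2 by rewrite div1r lef_pV2 ?posrE ?ltr0n ?(ltnW k_gt1) // (ler_nat _ 2).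
pose a := s / n%:R.
have a_le : a <= 2 * e by rewrite ler_pdivrMr //; lra.
have a0 : 0 <= a by rewrite divr_ge0.
have exp_le := @expR_le_quadratic R mu mu0 (le_trans muk e1).
have exp_ge : 0 <= expR mu - 1 by have := expR_ge1Dx mu; lra.
(* The target exponent is split evenly over the [n] vertices, using [s = n a]. *)
apply: (@le_trans _ _ (\prod_(v < n) expR (mu * (1 + 6 * e) * a))); last first.
  rewrite -expR_sum sumr_const card_ord -mulrnAr -(mulr_natr a) /a.
  by rewrite divfK ?gt_eqF.
apply: ler_prod => v _; rewrite addr_ge0 ?(mulr_ge0 (three_majority_ge0 _ _ _)) //=.
apply: le_trans (expR_ge1Dx _); rewrite lerD2l.
apply: (@le_trans _ _ (a * (1 + a) * (mu + 2 * mu ^+ 2))).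
  by apply: ler_pM; rewrite ?three_majority_ge0 ?three_majority_le //; lra.
have -> : a * (1 + a) * (mu + 2 * mu ^+ 2) = mu * a * ((1 + a) * (1 + 2 * mu)).
  ring.
rewrite (mulrAC mu _ a).
apply: ler_wpM2l; first exact: mulr_ge0.
(* Since [e <= 1 / 2], [4 e + 4 e^2 <= 6 e]; this is the origin of the constant 6. *)
apply: (@le_trans _ _ ((1 + 2 * e) * (1 + 2 * e))); last by nra.
by apply: ler_pM; lra.
Qed.

Lemma two_choices_mgf x i (mu : R) : (1 < k)%N ->
  0 <= mu -> mu <= 1 / 2 ->
  (opinion_count x i)%:R <= 2 * (n%:R / k%:R) :> R ->
  \sum_y trans (@two_choices R n k) x y * expR (mu * (opinion_count y i)%:R)
    <= expR (mu * (1 + 6 / k%:R) * (opinion_count x i)%:R).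
Proof.
move=> k_gt1 mu0 mu1; rewrite mgf_opinion_count; last exact: two_choices_sum1.
have n0 : 0 < n%:R :> R by rewrite ltr0n.
set s : R := (opinion_count x i)%:R => s_le.
have s0 : 0 <= s by rewrite ler0n.
set e := k%:R^-1 in s_le *.
have e0 : 0 < e by rewrite invr_gt0 ltr0n ltnW.
pose a := s / n%:R.
have a_le : a <= 2 * e by rewrite ler_pdivrMr //; lra.
have a0 : 0 <= a by rewrite divr_ge0.
have exp_le : expR mu - 1 <= 2 * mu.
  by have := @expR_le_quadratic R mu mu0 mu1; nra.
have exp_ge : 0 <= expR mu - 1 by have := expR_ge1Dx mu; lra.
apply: (@le_trans _ _
  (\prod_v (expR (mu * (x v == i)%:R) * expR (a ^+ 2 * (2 * mu))))).
  (* Vertices already holding [i] are bounded by [expR mu], with no second-order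
     loss: this is what allows a rate of constant order for 2-Choices. *)
  apply: ler_prod => v _; rewrite addr_ge0 ?(mulr_ge0 (two_choices_ge0 _ _ _)) //=.
  case: eqP => [_|/eqP ne] /=.
    rewrite mulr1; apply: (@le_trans _ _ (expR mu)).
      have : two_choices R x v i * (expR mu - 1) <= 1 * (expR mu - 1).
        by rewrite ler_wpM2r ?two_choices_le1.
      lra.
    by rewrite ler_peMr ?expR_ge0 // -[leLHS]expR0 ler_expR mulr_ge0 ?exprn_ge0 // mulr_ge0.
  rewrite mulr0 expR0 mul1r; apply: le_trans (expR_ge1Dx _); rewrite lerD2l.
  by apply: ler_pM; rewrite ?two_choices_ge0 ?two_choices_le.
rewrite big_split /= -expR_opinion_count -/s -expR_sum sumr_const card_ord.
rewrite -expRD ler_expR -(mulr_natr (a ^+ 2 * _)).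
(* The new adopters contribute a relative excess [2 a <= 4 e], within the allowed [6 e]. *)
have -> : a ^+ 2 * (2 * mu) * n%:R = a * 2 * (mu * s).
  by rewrite /a; field; rewrite gt_eqF.
have -> : mu * (1 + 6 * e) * s = mu * s + 6 * e * (mu * s) by ring.
by rewrite lerD2l ler_wpM2r ?mulr_ge0 //; lra.
Qed.

End Rules.

(** * Initial configuration, time horizon and conclusion *)

Lemma balanced_config (R : realType) (n k : nat) : (0 < k)%N ->
  exists x : config n k, forall i, (opinion_count x i)%:R <= n%:R / k%:R + 1 :> R.
Proof.
case: k => // k _; exists [ffun v : 'I_n => inord (v %% k.+1)] => i.
have : (opinion_count [ffun v : 'I_n => inord (v %% k.+1)] i <= (n %/ k.+1).+1)%N.
  rewrite -[leqRHS]card_ord.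
  (* Within a residue class, a vertex is determined by its quotient. *)
  apply: (@leq_card_in _ _ (fun v : 'I_n => inord (v %/ k.+1))) => v w.
  rewrite !inE !ffunE => /eqP hv /eqP hw /(congr1 val) /=.
  have bnd (u : 'I_n) : (u %/ k.+1 < (n %/ k.+1).+1)%N.
    by rewrite ltnS leq_div2r // ltnW.
  rewrite !inordK // => q; apply: val_inj => /=.
  have := congr1 val (etrans hv (esym hw)); rewrite /= !inordK ?ltn_pmod // => r.
  by rewrite (divn_eq v k.+1) (divn_eq w k.+1) q r.
rewrite -(ler_nat R) => /le_trans; apply.
rewrite -natr1 lerD2r ler_pdivlMr ?ltr0n // -natrM ler_nat.
exact: leq_trunc_div.
Qed.

(** The power is at most [expR (6 T / k) <= expR (1 / 4)], and [expR (- 1 / 4) >= 3 / 4]. *)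
Lemma growth_time (R : realType) (k T : nat) : (0 < k)%N ->
  T%:R < 1 / 24 * k%:R :> R -> (1 + 6 / k%:R : R) ^+ T <= 4 / 3.
Proof.
move=> k_gt0 T_lt; have k0 : 0 < k%:R :> R by rewrite ltr0n.
apply: (@le_trans _ _ (expR (1 / 4))).
  apply: (@le_trans _ _ (expR (6 / k%:R) ^+ T)).
    by rewrite lerXn2r ?nnegrE ?expR_ge0 ?expR_ge1Dx // addr_ge0 ?divr_ge0.
  rewrite -expRM_natl ler_expR mulrA ler_pdivrMr //; lra.
have := expR_ge1Dx (- (1 / 4) : R); rewrite expRN.
rewrite -[X in _ <= X]div1r ler_pdivlMr ?expR_gt0 //; lra.
Qed.

Lemma ln_nat_ge_half (R : realType) n : (2 <= n)%N -> 1 / 2 <= ln (n%:R : R).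
Proof.
move=> n2; have n0 : 0 < n%:R :> R by rewrite ltr0n ltnW.
have n2' : 2 <= n%:R :> R by rewrite (ler_nat _ 2).
rewrite -ler_expR lnK ?posrE //; apply: le_trans n2'.
by have := @expR_le_quadratic R (1 / 2); lra.
Qed.

Lemma consensus_time_ge (R : realType) (n k : nat)
    (rule : config n k -> 'I_n -> 'I_k -> R) (L : R) :
  (forall x v i, 0 <= rule x v i) ->
  (forall x v, \sum_i rule x v i = 1) ->
  (1 < k)%N -> (2 <= n)%N -> 0 < L -> L <= 1 ->
  (forall x i (mu : R), 0 <= mu -> mu <= L ->
     (opinion_count x i)%:R <= 2 * (n%:R / k%:R) :> R ->
     \sum_y trans rule x y * expR (mu * (opinion_count y i)%:R)
       <= expR (mu * (1 + 6 / k%:R) * (opinion_count x i)%:R)) ->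
  2 * ln n%:R <= L * (n%:R / k%:R) / 2 ->
  exists x0 : config n k,
    1 - expR 1 * (n%:R : R) `^ (- 1) <=
    Pr_tau_ge rule x0 `|Num.ceil (1 / 24 * k%:R : R)|%N.
Proof.
move=> rule_ge0 rule_sum1 k_gt1 n_gt1 L0 L1 mgf hln.
have n0 : 0 < n%:R :> R by rewrite ltr0n ltnW.
have k0 : 0 < k%:R :> R by rewrite ltr0n ltnW.
have [x0 x0_bal] := @balanced_config R n k (ltnW k_gt1); exists x0.
have : (0 < Num.ceil (1 / 24 * k%:R : R)) by rewrite ceil_gt0 mulr_gt0 // divr_gt0.
have := ceilB1_lt (1 / 24 * k%:R : R).
(* Reaching time [T.+1] means surviving [T] rounds, and the ceiling being [T.+1] gives
   [T < k / 24]. *)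
case: (Num.ceil _) => [[|T]|] //; rewrite intS addrC addKr => T_lt _ /=.
apply: le_trans; last first.
  apply: (escape_probability rule_ge0 rule_sum1 L0 k_gt1 mgf x0_bal).
  by apply: growth_time T_lt; exact: ltnW.
rewrite lerB // powRN powRr1 ?(ltW n0) //.
(* As [2 ln n >= 1] and [L <= 1], the last hypothesis forces [n / k >= 1]. The failure probability
   is then at most [n expR (1 - 2 ln n) = expR 1 / n]. *)
have k_le : k%:R <= n%:R :> R.
  have := ln_nat_ge_half R n_gt1.
  have q0 : 0 <= n%:R / k%:R :> R by rewrite divr_ge0 ?ltW.
  have : L * (n%:R / k%:R) <= n%:R / k%:R by rewrite ler_piMl.
  move=> h1 h2; have : 1 <= n%:R / k%:R :> R by lra.
  by rewrite ler_pdivlMr // mul1r.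
apply: (@le_trans _ _ (n%:R * expR (1 - 2 * ln n%:R))).
  by apply: ler_pM; rewrite ?expR_ge0 ?(ltW k0) // ler_expR; lra.
rewrite expRD mulrCA ler_pM2l ?expR_gt0 // expRN expRM_natl lnK ?posrE //.
by rewrite expr2 invfM mulrA divff ?mul1r // gt_eqF.
Qed.

Theorem theorem2p6 (R : realType) :
  (* (a) 3-Majority *)
  (exists c : R, 0 < c /\ exists c1 : R, 0 < c1 /\
   exists c' : R, 0 < c' /\ exists C : R, 0 < C /\ exists n0 : nat,
   forall n k : nat, (n0 <= n)%N -> (2 <= k)%N ->
     k%:R <= c * Num.sqrt (n%:R / ln (n%:R : R)) ->
     exists x0 : config n k,
       1 - C * (n%:R : R) `^ (- c') <=
       Pr_tau_ge (@three_majority R n k) x0 `|Num.ceil (c1 * k%:R)|%N)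
  /\
  (* (b) 2-Choices *)
  (exists c : R, 0 < c /\ exists c1 : R, 0 < c1 /\
   exists c' : R, 0 < c' /\ exists C : R, 0 < C /\ exists n0 : nat,
   forall n k : nat, (n0 <= n)%N -> (2 <= k)%N ->
     k%:R <= c * (n%:R / ln (n%:R : R)) ->
     exists x0 : config n k,
       1 - C * (n%:R : R) `^ (- c') <=
       Pr_tau_ge (@two_choices R n k) x0 `|Num.ceil (c1 * k%:R)|%N).
Proof.
split.
(* With [L = 1 / k] the required inequality is [4 k^2 ln n <= n], hence [c = 1 / 2]. *)
- exists (1 / 2); split; first lra.
  exists (1 / 24); split; first lra.
  exists 1; split; first lra.
  exists (expR 1); split; first exact: expR_gt0.
  exists 2%N => n k n2 k2 hk.
  have n0 : 0 < n%:R :> R by rewrite ltr0n ltnW.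
  have k0 : 0 < k%:R :> R by rewrite ltr0n ltnW.
  have ln0 : 0 < ln (n%:R : R) by have := ln_nat_ge_half R n2; lra.
  apply: (@consensus_time_ge R n k _ k%:R^-1) => //.
  + exact: three_majority_ge0.
  + by apply: three_majority_sum1; exact: ltnW.
  + by rewrite invr_gt0.
  + by rewrite invf_le1 // ler1n ltnW.
  + by move=> x i mu; apply: three_majority_mgf => //; exact: ltnW.
  have : k%:R ^+ 2 <= (1 / 2 * Num.sqrt (n%:R / ln (n%:R : R))) ^+ 2.
    by rewrite lerXn2r ?nnegrE ?(ltW k0) // (le_trans (ltW k0) hk).
  rewrite exprMn sqr_sqrtr; last by rewrite divr_ge0 ?ltW.
  rewrite mulrA ler_pdivlMr // => h.
  rewrite [leRHS](_ : _ = n%:R / 2 / k%:R ^+ 2); last by field; rewrite gt_eqF.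
  by rewrite ler_pdivlMr ?exprn_gt0 //; lra.
(* With [L = 1 / 2] it is [8 k ln n <= n], hence [c = 1 / 8]. *)
- exists (1 / 8); split; first lra.
  exists (1 / 24); split; first lra.
  exists 1; split; first lra.
  exists (expR 1); split; first exact: expR_gt0.
  exists 2%N => n k n2 k2 hk.
  have n0 : 0 < n%:R :> R by rewrite ltr0n ltnW.
  have k0 : 0 < k%:R :> R by rewrite ltr0n ltnW.
  have ln0 : 0 < ln (n%:R : R) by have := ln_nat_ge_half R n2; lra.
  apply: (@consensus_time_ge R n k _ (1 / 2)) => //.
  + exact: two_choices_ge0.
  + by apply: two_choices_sum1; exact: ltnW.
  + by lra.
  + by lra.
  + by move=> x i mu; apply: two_choices_mgf => //; exact: ltnW.
  move: hk; rewrite mulrA ler_pdivlMr // => h.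
  rewrite [leRHS](_ : _ = n%:R / 4 / k%:R); last by field; rewrite gt_eqF.
  by rewrite ler_pdivlMr //; lra.
Qed.
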